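(* Let $f(u)\in\mathbb{Q}[p_1,p_2,p_3,p_4][[u]]$ be the inversion (compositional inverse) of $\int_0^x\frac{dt}{\mathcal{B}(t)}$. Then the series $$\xi_1(u)=\mathcal{A}(f(u))=f'^2(u)-\frac12\big(f''(u)+f''(0)f'(u)\big)f(u)+\frac12\big(f''^2(0)-f'''(0)\big)f^2(u),$$ $$\xi_2(u)=\mathcal{B}(f(u))=f'(u)$$ (where the displayed equalities are part of the assertion) satisfy $$f(u+v)=\frac{f(u)^2\xi_1(v)-f(v)^2\xi_1(u)}{f(u)\xi_2(v)-f(v)\xi_2(u)}.$$
   Context: Over the polynomial ring $\mathbb{Q}[p_1,p_2,p_3,p_4]$ put $\mathcal{R}(x)=\sqrt{1+p_1x+p_2x^2+p_3x^3+p_4x^4}$ (the square root with constant term $1$). The series $\mathcal{B}(x)$ is the unique formal power series with $\mathcal{B}(0)=1$ such that, with $\mu(x):=x/\mathcal{B}(x)$, one has $\mathcal{B}(x)=\mathcal{R}(\mu(x))/\mu'(x)$. Further, $$\mathcal{A}(x):=\mathcal{B}^2(x)-\tfrac12x\mathcal{B}(x)\mathcal{B}'(x)+\tfrac14p_1x\mathcal{B}(x)-\left(\tfrac1{16}p_1^2-\tfrac14p_2\right)x^2.$$ Notation: $f'^2(u)=(f'(u))^2$, $f''^2(0)=(f''(0))^2$, $f^2(u)=(f(u))^2$. *)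

(* Defs.v *)
From HB Require Import structures.
From mathcomp Require Import all_boot all_order all_algebra.
From mathcomp Require Import fraction.
From mathcomp Require Import boolp.
From mathcomp Require Export mpoly.

Set Implicit Arguments.
Unset Strict Implicit.
Unset Printing Implicit Defensive.

Import GRing.Theory.
Local Open Scope ring_scope.

Record fps (R : Type) := Fps { coeff : nat -> R }.

Notation "{ 'fps' R }" := (fps R) (at level 0, format "{ 'fps'  R }") : type_scope.

(* Equality of series is undecidable, so the eqType and choiceType structures
   come from classical logic. *)
HB.instance Definition _ (R : Type) := gen_eqMixin {fps R}.
HB.instance Definition _ (R : Type) := gen_choiceMixin {fps R}.

Lemma fpsP (R : Type) (F G : {fps R}) : (forall n, coeff F n = coeff G n) -> F = G.
Proof. by case: F G => [a] [b] /= ab; congr Fps; apply: funext. Qed.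

Section Zmod.
Variable R : zmodType.
Implicit Types F G H : {fps R}.

Definition fps_zero : {fps R} := Fps (fun=> 0).
Definition fps_opp F : {fps R} := Fps (fun n => - coeff F n).
Definition fps_add F G : {fps R} := Fps (fun n => coeff F n + coeff G n).

Fact fps_addA : associative fps_add.
Proof. by move=> F G H; apply: fpsP => n /=; rewrite addrA. Qed.
Fact fps_addC : commutative fps_add.
Proof. by move=> F G; apply: fpsP => n /=; rewrite addrC. Qed.
Fact fps_add0 : left_id fps_zero fps_add.
Proof. by move=> F; apply: fpsP => n /=; rewrite add0r. Qed.
Fact fps_addN : left_inverse fps_zero fps_opp fps_add.
Proof. by move=> F; apply: fpsP => n /=; rewrite addNr. Qed.

HB.instance Definition _ := GRing.isZmodule.Build {fps R}
  fps_addA fps_addC fps_add0 fps_addN.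

Lemma coeff0 n : coeff (0 : {fps R}) n = 0. Proof. by []. Qed.
Lemma coeffN F n : coeff (- F) n = - coeff F n. Proof. by []. Qed.
Lemma coeffD F G n : coeff (F + G) n = coeff F n + coeff G n. Proof. by []. Qed.
Lemma coeffB F G n : coeff (F - G) n = coeff F n - coeff G n. Proof. by []. Qed.
End Zmod.

Section Ring.
Variable R : comNzRingType.
Implicit Types F G H : {fps R}.

Definition fpsC (c : R) : {fps R} := Fps (fun n => if n is 0 then c else 0).
Definition fps_mul F G : {fps R} :=
  Fps (fun n => \sum_(i < n.+1) coeff F i * coeff G (n - i)).

(* The truncation to degree at most n is multiplicative up to that degree,
   which transfers the ring laws from {poly R}. *)
Let trunc n F : {poly R} := \poly_(i < n.+1) coeff F i.

Let coef_trunc n F i : (i <= n)%N -> (trunc n F)`_i = coeff F i.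
Proof. by move=> le_in; rewrite coef_poly ltnS le_in. Qed.

Let coef_truncM n F G i : (i <= n)%N ->
  (trunc n F * trunc n G)`_i = coeff (fps_mul F G) i.
Proof.
move=> le_in; rewrite coefM; apply: eq_bigr => j _.
have le_ji : (j <= i)%N by rewrite -ltnS.
by rewrite !coef_trunc ?(leq_trans le_ji) ?(leq_trans (leq_subr _ _)).
Qed.

Fact fps_mulA : associative fps_mul.
Proof.
move=> F G H; apply: fpsP => n.
transitivity ((trunc n F * (trunc n G * trunc n H))`_n); last first.
  rewrite mulrA [in LHS]coefM; apply: eq_bigr => j _.
  have le_jn : (j <= n)%N by rewrite -ltnS.
  by rewrite coef_truncM // coef_trunc // leq_subr.
rewrite coefM; apply: eq_bigr => j _.
have le_jn : (j <= n)%N by rewrite -ltnS.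
by rewrite coef_truncM ?leq_subr // coef_trunc.
Qed.
Fact fps_mulC : commutative fps_mul.
Proof.
by move=> F G; apply: fpsP => n; rewrite -!(@coef_truncM n) // mulrC.
Qed.
Fact fps_mul1 : left_id (fpsC 1) fps_mul.
Proof.
move=> F; apply: fpsP => n /=; rewrite big_ord_recl mul1r subn0.
by rewrite big1 ?addr0 // => i _; rewrite mul0r.
Qed.
Fact fps_mulDl : left_distributive fps_mul (@fps_add R).
Proof.
move=> F G H; apply: fpsP => n /=; rewrite -big_split.
by apply: eq_bigr => i _; rewrite mulrDl.
Qed.
Fact fps_1neq0 : fpsC 1 != 0.
Proof. by apply/eqP => /(congr1 (fun F => coeff F 0%N)) /eqP; rewrite /= oner_eq0. Qed.

HB.instance Definition _ := GRing.Zmodule_isComNzRing.Build {fps R}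
  fps_mulA fps_mulC fps_mul1 fps_mulDl fps_1neq0.

Lemma coeffM F G n :
  coeff (F * G) n = \sum_(i < n.+1) coeff F i * coeff G (n - i).
Proof. by []. Qed.
Lemma coeff1 n : coeff (1 : {fps R}) n = (n == 0%N)%:R. Proof. by case: n. Qed.

End Ring.

Section Operations.
Variable R : comNzRingType.
Implicit Types F G H : {fps R}.

Definition fps_scale (c : R) F : {fps R} := Fps (fun n => c * coeff F n).

Fact fps_scaleA a b F : fps_scale a (fps_scale b F) = fps_scale (a * b) F.
Proof. by apply: fpsP => n /=; rewrite mulrA. Qed.
Fact fps_scale1 : left_id 1 fps_scale.
Proof. by move=> F; apply: fpsP => n /=; rewrite mul1r. Qed.
Fact fps_scaleDr : right_distributive fps_scale +%R.
Proof. by move=> a F G; apply: fpsP => n /=; rewrite mulrDr. Qed.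
Fact fps_scaleDl F : {morph fps_scale^~ F : a b / a + b}.
Proof. by move=> a b; apply: fpsP => n /=; rewrite mulrDl. Qed.

HB.instance Definition _ := GRing.Zmodule_isLmodule.Build R {fps R}
  fps_scaleA fps_scale1 fps_scaleDr fps_scaleDl.

Fact fps_scaleAl (a : R) F G : a *: (F * G) = a *: F * G.
Proof.
apply: fpsP => n; rewrite /= big_distrr /=.
by apply: eq_bigr => i _; rewrite mulrA.
Qed.

HB.instance Definition _ := GRing.Lmodule_isLalgebra.Build R {fps R} fps_scaleAl.
HB.instance Definition _ := GRing.Lalgebra_isComAlgebra.Build R {fps R}.

Lemma coeffZ c F n : coeff (c *: F) n = c * coeff F n. Proof. by []. Qed.

Definition fpsX : {fps R} := Fps (fun n => (n == 1%N)%:R).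

Definition fps_deriv F : {fps R} := Fps (fun n => coeff F n.+1 *+ n.+1).

(* G(H(x)).  Only the terms k <= n reach degree n when H(0) = 0, and the
   definition is meaningful only in that case. *)
Definition fps_comp G H : {fps R} :=
  Fps (fun n => \sum_(k < n.+1) coeff G k * coeff (H ^+ k) n).

Definition fps_comp_inverse F G : Prop :=
  [/\ coeff F 0 = 0, coeff G 0 = 0,
      fps_comp F G = fpsX & fps_comp G F = fpsX].

(* S is the square root of F with constant term 1. *)
Definition fps_sqrt S F : Prop := coeff S 0 = 1 /\ S ^+ 2 = F.

End Operations.

Section UnitRing.
Variable R : comUnitRingType.
Implicit Types F G : {fps R}.

(* The first n.+1 coefficients of F^-1. *)
Fixpoint fps_inv_seq F n : seq R :=
  if n is m.+1 then
    let s := fps_inv_seq F m in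
    rcons s (- (coeff F 0)^-1 * \sum_(i < m.+1) coeff F i.+1 * s`_(m - i))
  else [:: (coeff F 0)^-1].

Definition fps_unit : pred {fps R} := fun F => coeff F 0 \is a GRing.unit.
Definition fps_inv F : {fps R} :=
  if F \in fps_unit then Fps (fun n => (fps_inv_seq F n)`_n) else F.

Let size_inv_seq F n : size (fps_inv_seq F n) = n.+1.
Proof. by elim: n => //= n IHn; rewrite size_rcons IHn. Qed.

Let nth_inv_seq F n i : (i <= n)%N -> (fps_inv_seq F n)`_i = (fps_inv_seq F i)`_i.
Proof.
elim: n => [|n IHn]; first by rewrite leqn0 => /eqP->.
rewrite leq_eqVlt => /orP[/eqP->//|lt_in].
by rewrite /= nth_rcons size_inv_seq lt_in IHn.
Qed.

Fact fps_mulVr : {in fps_unit, left_inverse 1 fps_inv *%R}.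
Proof.
move=> F UF; rewrite mulrC /fps_inv UF; apply: fpsP => -[|n].
  by rewrite coeffM big_ord1 /= divrr.
rewrite coeffM big_ord_recl /= nth_rcons size_inv_seq ltnn eqxx.
rewrite mulNr mulrN mulVKr //; apply/eqP; rewrite addrC subr_eq0; apply/eqP.
apply: eq_bigr => i _; rewrite /bump /= add1n subSS.
by rewrite (@nth_inv_seq F n) // leq_subr.
Qed.
Fact fps_unitP F G : G * F = 1 -> F \in fps_unit.
Proof.
move/(congr1 (fun H => coeff H 0%N)); rewrite coeffM big_ord1 /= => GF1.
by apply/unitrPr; exists (coeff G 0); rewrite mulrC.
Qed.
Fact fps_inv_out : {in [predC fps_unit], fps_inv =1 id}.
Proof. by move=> F /negbTE /= UF; rewrite /fps_inv UF. Qed.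

HB.instance Definition _ := GRing.ComNzRing_hasMulInverse.Build {fps R}
  fps_mulVr fps_unitP fps_inv_out.

End UnitRing.

(* The integral from 0, meaningful when every n.+1%:R is a unit of R. *)
Definition fps_int (R : comUnitRingType) (F : {fps R}) : {fps R} :=
  Fps (fun n => if n is m.+1 then coeff F m / n%:R else 0).

Section IntegralDomain.
Variable R : idomainType.

Fact fps_idomain (F G : {fps R}) : F * G = 0 -> (F == 0) || (G == 0).
Proof.
have low (H : {fps R}) : H != 0 ->
    exists2 n, coeff H n != 0 & forall m, (m < n)%N -> coeff H m = 0.
  move=> H0; have exH : exists n, coeff H n != 0.
    apply: contrapT => nexH; case/eqP: H0; apply: fpsP => n.
    by apply/eqP; apply: contrapT => /negP Hn; apply: nexH; exists n.
  case: (ex_minnP exH) => n Hn minn; exists n => // m; rewrite ltnNge.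
  by apply: contraNeq => /minn.
move=> FG0; apply: contrapT => /negP; rewrite negb_or => /andP[/low[a Fa lowF]].
case/low => b Gb lowG; have := congr1 (fun H => coeff H (a + b)%N) FG0.
rewrite coeffM coeff0 (bigD1 (Ordinal (leq_addr b a : (a < (a + b).+1)%N))) //=.
rewrite addKn big1 ?addr0 => [/eqP|i].
  by rewrite mulf_eq0 (negbTE Fa) (negbTE Gb).
rewrite -val_eqE /= neq_ltn => /orP[/lowF->|lt_ai]; first by rewrite mul0r.
by rewrite lowG ?mulr0 // ltn_subLR ?ltn_add2r // -ltnS.
Qed.

HB.instance Definition _ :=
  GRing.ComUnitRing_isIntegral.Build {fps R} fps_idomain.
End IntegralDomain.

(* R[[u,v]] is represented as R[[v]][[u]]: the coefficient of u^i v^j in H is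
   coeff (coeff H i) j. *)
Section Bivariate.
Variable R : comNzRingType.

Definition fpsU : {fps {fps R}} := fpsX {fps R}.
Definition fpsV : {fps {fps R}} := fpsC (fpsX R).

(* G(H(u,v)), meaningful when H has zero constant term. *)
Definition fps_comp2 (G : {fps R}) (H : {fps {fps R}}) : {fps {fps R}} :=
  Fps (fun i => Fps (fun j =>
    \sum_(k < (i + j).+1) coeff G k * coeff (coeff (H ^+ k) i) j)).
End Bivariate.

Arguments fpsX {R}.
Arguments fpsU {R}.
Arguments fpsV {R}.

Notation "F \oS G" := (fps_comp F G) (at level 50, format "F  \oS  G").
Notation "F \oS2 G" := (fps_comp2 F G) (at level 50, format "F  \oS2  G").
Notation "F ^`S" := (fps_deriv F) (at level 1, left associativity, format "F ^`S").

Notation Qp := {mpoly rat[4]}.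

Definition p1 : Qp := 'X_(inord 0).
Definition p2 : Qp := 'X_(inord 1).
Definition p3 : Qp := 'X_(inord 2).
Definition p4 : Qp := 'X_(inord 3).

Definition quartic : {fps Qp} :=
  1 + p1 *: fpsX + p2 *: fpsX ^+ 2 + p3 *: fpsX ^+ 3 + p4 *: fpsX ^+ 4.

Definition mu (B : {fps Qp}) : {fps Qp} := fpsX / B.

Definition calA (B : {fps Qp}) : {fps Qp} :=
  B ^+ 2 - (1 / 2) *: (fpsX * B * B^`S) + (1 / 4 * p1) *: (fpsX * B)
  - (1 / 16 * p1 ^+ 2 - 1 / 4 * p2) *: fpsX ^+ 2.

(* Main.v *)
(* Put g = mu(f), so that g f' = f and g'^2 = 1 + p1 g + p2 g^2 + p3 g^3 + p4 g^4.
   Let N and D be the numerator and the denominator of the addition formula.  The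
   equation for g gives D dN = N dD for the derivation d = d/du - d/dv, which
   kills f(u + v).  Hence E = N - f(u + v) D satisfies D dE = E dD and vanishes at
   u = 0, whereas D does not; comparing lowest order terms in u gives E = 0. *)

Require Import Defs.
From HB Require Import structures.
From mathcomp Require Import all_boot all_order all_algebra fraction.
From mathcomp Require Import ring.

Set Implicit Arguments.
Unset Strict Implicit.
Unset Printing Implicit Defensive.

Import GRing.Theory.
Local Open Scope ring_scope.

(** * Formal power series in one variable: coefficients, constants, derivation *)

Section Zmodule.
Variable R : zmodType.

Lemma coeff_sum I (r : seq I) (P : pred I) (F : I -> {fps R}) n :
  coeff (\sum_(i <- r | P i) F i) n = \sum_(i <- r | P i) coeff (F i) n.
Proof. by elim/big_rec2: _ => // i x y _ <-. Qed.

Lemma coeffMn (F : {fps R}) k n : coeff (F *+ k) n = coeff F n *+ k.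
Proof. by elim: k => // k IHk; rewrite !mulrS coeffD IHk. Qed.

End Zmodule.

Section Series.
Variable R : comNzRingType.
Implicit Types F G H : {fps R}.

Lemma coeff0M F G : coeff (F * G) 0 = coeff F 0 * coeff G 0.
Proof. by rewrite coeffM big_ord1. Qed.

Lemma coeff0X F n : coeff (F ^+ n) 0 = coeff F 0 ^+ n.
Proof. by elim: n => // n IHn; rewrite !exprS coeff0M IHn. Qed.

Lemma coeff_CM (c : R) F n : coeff (fpsC c * F) n = c * coeff F n.
Proof.
rewrite coeffM big_ord_recl /= subn0 big1 ?addr0 // => i _.
by rewrite mul0r.
Qed.

Lemma fps_scaleC (c : R) F : c *: F = fpsC c * F.
Proof. by apply: fpsP => n; rewrite coeff_CM. Qed.

Fact fpsC_is_zmod_morphism : zmod_morphism (@fpsC R).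
Proof. by move=> a b; apply: fpsP => -[|n] //=; rewrite subr0. Qed.
Fact fpsC_is_monoid_morphism : monoid_morphism (@fpsC R).
Proof.
by split=> // a b; apply: fpsP => n; rewrite coeff_CM; case: n => //=; rewrite mulr0.
Qed.
HB.instance Definition _ :=
  GRing.isZmodMorphism.Build R {fps R} (@fpsC R) fpsC_is_zmod_morphism.
HB.instance Definition _ :=
  GRing.isMonoidMorphism.Build R {fps R} (@fpsC R) fpsC_is_monoid_morphism.

Lemma fpsC_inj : injective (@fpsC R).
Proof. by move=> a b /(congr1 (fun F => coeff F 0%N)). Qed.

Fact fps_deriv_is_zmod_morphism : zmod_morphism (@fps_deriv R).
Proof. by move=> F G; apply: fpsP => n /=; rewrite mulrnBl. Qed.
HB.instance Definition _ := GRing.isZmodMorphism.Build {fps R} {fps R}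
  (@fps_deriv R) fps_deriv_is_zmod_morphism.

Lemma fps_derivD F G : (F + G)^`S = F^`S + G^`S.
Proof. exact: raddfD. Qed.

Lemma fps_derivB F G : (F - G)^`S = F^`S - G^`S.
Proof. exact: raddfB. Qed.

Lemma fps_derivC (c : R) : (fpsC c)^`S = 0.
Proof. by apply: fpsP => n /=; rewrite mul0rn. Qed.

Lemma fps_deriv0 : (0 : {fps R})^`S = 0.
Proof. exact: raddf0. Qed.

Lemma fps_deriv1 : (1 : {fps R})^`S = 0.
Proof. exact: fps_derivC. Qed.

Lemma fps_derivX : (@fpsX R)^`S = 1.
Proof. by apply: fpsP => -[|n] //=; rewrite mul0rn. Qed.

Lemma fps_derivM F G : (F * G)^`S = F^`S * G + F * G^`S.
Proof.
apply: fpsP => n; rewrite coeffD !coeffM /= -sumrMnl.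
(* The weight [n + 1] is shared between the degrees of the two factors, one share for each term of
   the product rule. *)
have splitn (x : R) (i : 'I_n.+2) : x *+ n.+1 = x *+ i + x *+ (n.+1 - i).
  by rewrite -mulrnDr subnKC // -ltnS.
under [LHS]eq_bigr => i _ do rewrite (splitn _ i).
rewrite big_split /=; congr (_ + _).
  rewrite big_ord_recl /= mulr0n add0r; apply: eq_bigr => i _.
  by rewrite /= /bump add1n subSS mulrnAl.
rewrite big_ord_recr /= subnn mulr0n addr0; apply: eq_bigr => i _.
by rewrite subSn ?mulrnAr // -ltnS.
Qed.

Lemma fps_derivXn F n : (F ^+ n.+1)^`S = F ^+ n * F^`S *+ n.+1.
Proof.
elim: n => [|n IHn]; first by rewrite expr0 mul1r.
rewrite exprS fps_derivM IHn mulrnAr mulrA -exprS [F^`S * _]mulrC.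
by rewrite [RHS]mulrS.
Qed.

Lemma coeff_exp_small H k n : coeff H 0 = 0 -> (n < k)%N -> coeff (H ^+ k) n = 0.
Proof.
move=> H0; elim: k n => // k IHk n lt_nk; rewrite exprS coeffM big_ord_recl.
rewrite H0 mul0r add0r big1 // => i _; rewrite IHk ?mulr0 //=.
by rewrite /bump add1n ltn_subLR // (leq_trans lt_nk) // addSn ltnS leq_addl.
Qed.

Lemma coeff_Xn k n : coeff ((fpsX : {fps R}) ^+ k) n = (n == k)%:R.
Proof.
elim: k n => [|k IHk] n; first by rewrite coeff1.
rewrite exprS coeffM; case: n => [|n].
  by rewrite big_ord1 /= mul0r.
rewrite !big_ord_recl /= mul0r add0r mul1r /bump /= subSS subn0 IHk.
by rewrite big1 ?addr0 // => i _; rewrite /= mul0r.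
Qed.

End Series.

(** * Substitution of a series without constant term; the chain rule *)

Section Composition.
Variables (R : comNzRingType) (H : {fps R}).
Hypothesis H0 : coeff H 0 = 0.
Implicit Types F G : {fps R}.

(** Since [H ^+ k] starts in degree [k], the cut-off of the sum is immaterial once it exceeds [n]; a
    common bound can then be chosen for several coefficients. *)
Lemma coeff_comp_wide G n N : (n < N)%N ->
  coeff (G \oS H) n = \sum_(k < N) coeff G k * coeff (H ^+ k) n.
Proof.
move=> lt_nN /=; rewrite (big_ord_widen N (fun k => coeff G k * coeff (H ^+ k) n)) //.
rewrite [RHS](bigID (fun k : 'I_N => k < n.+1)%N) /= [X in _ + X]big1 ?addr0 //.
by move=> k; rewrite -leqNgt => le_nk; rewrite coeff_exp_small ?mulr0.
Qed.

Lemma fps_compD F G : (F + G) \oS H = (F \oS H) + (G \oS H).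
Proof.
by apply: fpsP => n /=; rewrite -big_split /=; apply: eq_bigr => k _; rewrite mulrDl.
Qed.

Lemma fps_compN F : (- F) \oS H = - (F \oS H).
Proof.
by apply: fpsP => n /=; rewrite -sumrN; apply: eq_bigr => k _; rewrite mulNr.
Qed.

Lemma fps_compC (c : R) : fpsC c \oS H = fpsC c.
Proof.
apply: fpsP => n /=; rewrite big_ord_recl expr0 big1 => [|i _].
  by rewrite addr0 coeff1; case: n => [|n]; rewrite ?mulr1 ?mulr0.
by rewrite mul0r.
Qed.

Lemma fps_comp1 : 1 \oS H = 1.
Proof. exact: (fps_compC 1). Qed.

Lemma fps_compX : fpsX \oS H = H.
Proof.
apply: fpsP => n; rewrite (@coeff_comp_wide _ _ n.+2) ?ltnS //.
rewrite !big_ord_recl /= mul0r add0r mul1r expr1 big1 ?addr0 // => i _.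
by rewrite mul0r.
Qed.

(* Modulo the powers of H that vanish to order n, composition is evaluation at
   H of a truncating polynomial. *)
Lemma coeff_comp_horner (p : {poly R}) F n : (forall k, (k <= n)%N -> p`_k = coeff F k) ->
  coeff (F \oS H) n = coeff (map_poly (@fpsC R) p).[H] n.
Proof.
move=> pF; rewrite (@horner_coef_wide _ (maxn n.+1 (size p))); last first.
  by rewrite (leq_trans (size_poly _ _)) // leq_maxr.
rewrite coeff_sum (@coeff_comp_wide _ _ (maxn n.+1 (size p))) ?leq_maxl //.
apply: eq_bigr => k _; rewrite coef_map coeff_CM.
have [/pF-> //|lt_nk] := leqP k n.
by rewrite coeff_exp_small // !mulr0.
Qed.

(** Up to degree [n] both factors may be replaced by polynomials, for which evaluation at [H] is
    multiplicative. *)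
Lemma fps_compM F G : (F * G) \oS H = (F \oS H) * (G \oS H).
Proof.
apply: fpsP => n; pose t F := \poly_(i < n.+1) coeff F i.
have tE K k : (k <= n)%N -> (t K)`_k = coeff K k by move=> le_kn; rewrite coef_poly ltnS le_kn.
rewrite (@coeff_comp_horner (t F * t G)) => [|k le_kn]; last first.
  rewrite coefM coeffM; apply: eq_bigr => i _.
  by rewrite !tE // ?(leq_trans (leq_subr _ _)) // (leq_trans _ le_kn) // -ltnS.
rewrite rmorphM hornerM !coeffM; apply: eq_bigr => i _.
have le_in : (i <= n)%N by rewrite -ltnS.
congr (_ * _); symmetry; apply: coeff_comp_horner => k le_k.
  by rewrite tE // (leq_trans le_k).
by rewrite tE // (leq_trans le_k) // leq_subr.
Qed.

Lemma fps_compXn F n : (F ^+ n) \oS H = (F \oS H) ^+ n.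
Proof.
elim: n => [|n IHn]; first exact: fps_comp1.
by rewrite !exprS fps_compM IHn.
Qed.

Lemma coeff0_comp F : coeff (F \oS H) 0 = coeff F 0.
Proof. by rewrite /= big_ord1 expr0 mulr1. Qed.

(** The power rule is applied term by term; giving the inner sums one common bound allows the two
    summations to be exchanged. *)
Lemma fps_deriv_comp F : (F \oS H)^`S = (F^`S \oS H) * H^`S.
Proof.
apply: fpsP => n; rewrite [LHS]/= big_ord_recl expr0 coeff1 mulr0 add0r.
rewrite coeffM; under [RHS]eq_bigr => m _.
  rewrite (@coeff_comp_wide _ _ n.+1) // mulr_suml.
  over.
rewrite exchange_big /= -sumrMnl; apply: eq_bigr => k _.
transitivity (coeff F k.+1 * coeff ((H ^+ k.+1)^`S) n); first by rewrite mulrnAr.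
rewrite fps_derivXn coeffMn mulrnAr -mulrnAl coeffM mulr_sumr.
by apply: eq_bigr => i _; rewrite mulrA.
Qed.

End Composition.

(** * Series in [u] and [v], and the derivation that kills functions of [u + v] *)

Section Bivariate.
Variable R : comNzRingType.
Implicit Types (F : {fps R}) (H : {fps {fps R}}).

(* F(u); the embedding F(v) is fpsC F. *)
Definition fps_inU F : {fps {fps R}} := Fps (fun i => fpsC (coeff F i)).

Fact fps_inU_is_zmod_morphism : zmod_morphism fps_inU.
Proof. by move=> F G; apply: fpsP => n /=; rewrite rmorphB. Qed.
Fact fps_inU_is_monoid_morphism : monoid_morphism fps_inU.
Proof.
split=> [|F G]; apply: fpsP => n; first by case: n => //=; rewrite rmorph0.
rewrite coeffM /= rmorph_sum; apply: eq_bigr => i _.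
by rewrite -rmorphM.
Qed.
HB.instance Definition _ :=
  GRing.isZmodMorphism.Build {fps R} {fps {fps R}} fps_inU fps_inU_is_zmod_morphism.
HB.instance Definition _ :=
  GRing.isMonoidMorphism.Build {fps R} {fps {fps R}} fps_inU fps_inU_is_monoid_morphism.

Lemma fps_inU_inj : injective fps_inU.
Proof.
move=> F G FG; apply: fpsP => n; apply: fpsC_inj.
exact: (congr1 (fun H => coeff H n) FG).
Qed.

Lemma fps_inU_C (c : R) : fps_inU (fpsC c) = fpsC (fpsC c).
Proof. by apply: fpsP => -[|n] //=; rewrite rmorph0. Qed.

Lemma coeff_VU a b i j :
  coeff (coeff ((@fpsV R) ^+ a * (@fpsU R) ^+ b) i) j = ((i == b) && (j == a))%:R.
Proof.
rewrite /fpsV -rmorphXn coeff_CM coeff_Xn mulr_natr coeffMn coeff_Xn.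
by case: (i == b).
Qed.

Lemma fps_comp2U F : F \oS2 fpsU = fps_inU F.
Proof.
apply: fpsP => i; apply: fpsP => j /=.
under eq_bigr => k _ do rewrite -[_ ^+ k]mul1r -[1](expr0 (@fpsV R)) coeff_VU.
case: j => [|j] /=; last first.
  by rewrite big1 // => k _; rewrite andbF mulr0.
rewrite addn0 big_ord_recr /= !eqxx /= mulr1 big1 ?add0r // => k _.
by rewrite gtn_eqF ?mulr0.
Qed.

Lemma fps_comp2V F : F \oS2 fpsV = fpsC F.
Proof.
apply: fpsP => i; apply: fpsP => j /=.
under eq_bigr => k _ do rewrite -[_ ^+ k]mulr1 -[1](expr0 (@fpsU R)) coeff_VU.
case: i => [|i] /=; last by rewrite big1 // => k _; rewrite mulr0.
rewrite add0n big_ord_recr /= eqxx /= mulr1 big1 ?add0r // => k _.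
by rewrite gtn_eqF ?mulr0.
Qed.

(** By the binomial theorem [u^i v^j] occurs only in the power [k = i + j], the last one that the
    cut-off in [fps_comp2] keeps. *)
Lemma coeff_comp2UV F i j :
  coeff (coeff (F \oS2 (fpsU + fpsV)) i) j = coeff F (i + j) *+ 'C(i + j, i).
Proof.
have cE k : coeff (coeff ((fpsU + fpsV : {fps {fps R}}) ^+ k) i) j
    = (k == i + j)%:R *+ 'C(i + j, i).
  rewrite addrC exprDn coeff_sum coeff_sum.
  under eq_bigr => l _ do rewrite !coeffMn coeff_VU.
  have [->|/eqP kij] := k =P (i + j)%N.
    have lt_i : (i < (i + j).+1)%N by rewrite ltnS leq_addr.
    rewrite (bigD1 (Ordinal lt_i)) //= eqxx addKn eqxx big1 ?addr0 // => l.
    by rewrite -val_eqE eq_sym /= => /negbTE->; rewrite mul0rn.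
  rewrite mul0rn big1 // => l _; case: eqP => [il|_] /=; last by rewrite mul0rn.
  case: eqP => [jl|_]; last by rewrite mul0rn.
  by case/eqP: kij; rewrite il jl subnKC // -ltnS.
rewrite /= big_ord_recr /= cE eqxx big1 ?add0r => [|k _].
  by rewrite mulrnAr mulr1.
by rewrite cE ltn_eqF // mul0rn mulr0.
Qed.

Definition fps_derivV H : {fps {fps R}} := Fps (fun i => (coeff H i)^`S).

(** This is the derivation d/du - d/dv: the outer variable is [u], so the [v] derivative acts on
    coefficients. *)
Definition fps_derivUV H := H^`S - fps_derivV H.

Lemma fps_derivVM H K : fps_derivV (H * K) = fps_derivV H * K + H * fps_derivV K.
Proof.
apply: fpsP => n; rewrite coeffD !coeffM /= -big_split /=.
have dsum (I : Type) (r : seq I) (G : I -> {fps R}) :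
    (\sum_(i <- r) G i)^`S = \sum_(i <- r) (G i)^`S.
  elim/big_rec2: _ => [|i x y _ <-]; last by rewrite fps_derivD.
  by rewrite fps_deriv0.
by rewrite dsum; apply: eq_bigr => i _; rewrite fps_derivM.
Qed.

Lemma fps_derivUVM H K : fps_derivUV (H * K) = fps_derivUV H * K + H * fps_derivUV K.
Proof. by rewrite /fps_derivUV fps_derivVM fps_derivM; ring. Qed.

Fact fps_derivUV_is_zmod_morphism : zmod_morphism fps_derivUV.
Proof.
move=> H K; apply: fpsP => n; rewrite /fps_derivUV !coeffB /= mulrnBl.
have -> : (coeff H n - coeff K n)^`S = (coeff H n)^`S - (coeff K n)^`S.
  by apply: fpsP => m /=; rewrite mulrnBl.
by ring.
Qed.
HB.instance Definition _ :=
  GRing.isZmodMorphism.Build {fps {fps R}} {fps {fps R}} fps_derivUV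
    fps_derivUV_is_zmod_morphism.

Lemma fps_derivUVB H K : fps_derivUV (H - K) = fps_derivUV H - fps_derivUV K.
Proof. exact: raddfB. Qed.

Lemma fps_derivUV_inU F : fps_derivUV (fps_inU F) = fps_inU F^`S.
Proof.
apply: fpsP => n; rewrite /fps_derivUV coeffB /= fps_derivC subr0.
by rewrite raddfMn.
Qed.

Lemma fps_derivUV_C F : fps_derivUV (fpsC F) = - fpsC F^`S.
Proof.
rewrite /fps_derivUV fps_derivC sub0r; congr (- _).
by apply: fpsP => -[|n] //=; rewrite fps_deriv0.
Qed.

(** At [u^i v^j] the two partial derivatives agree because
    [(i+1) C(i+j+1, i+1) = (j+1) C(i+j+1, i)]. *)
Lemma fps_derivUV_comp2 F : fps_derivUV (F \oS2 (fpsU + fpsV)) = 0.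
Proof.
apply: fpsP => i; apply: fpsP => j; pose W := F \oS2 (fpsU + fpsV).
change (coeff (coeff W i.+1 *+ i.+1) j - coeff (coeff W i) j.+1 *+ j.+1 = 0).
rewrite coeffMn !coeff_comp2UV addSn addnS -!mulrnA.
rewrite [(_ * i.+1)%N]mulnC mul_bin_left subSn ?leq_addr // addKn mulnC.
by rewrite subrr.
Qed.

End Bivariate.

(** * Characteristic zero and uniqueness for the first-order equation *)

Lemma pchar0_mulrn_eq0 (R : idomainType) (n : nat) (x : R) :
  [pchar R] =i pred0 -> x *+ n.+1 = 0 -> x = 0.
Proof.
move=> /pcharf0P charR /eqP; rewrite -mulr_natr mulf_eq0 charR orbF.
by move=> /eqP.
Qed.

Section Uniqueness.
Variable R : idomainType.
Hypothesis charR : [pchar R] =i pred0.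

Lemma fps_pchar0 : [pchar {fps R}] =i pred0.
Proof.
apply/pcharf0P => -[|n]; first by rewrite mulr0n !eqxx.
apply: negbTE; apply/eqP => /(congr1 (fun F => coeff F 0%N)); rewrite coeffMn => /eqP.
by apply/negP/negbT; apply: (pcharf0P R).1 charR n.+1.
Qed.

(* The equation says that E / D is a function of u + v; compare the lowest
   order terms in u of both sides. *)
Lemma fps_derivUV_uniq (D E : {fps {fps R}}) :
  D * fps_derivUV E = E * fps_derivUV D -> coeff D 0 != 0 -> coeff E 0 = 0 ->
  E = 0.
Proof.
move=> DE D0 E0; apply: fpsP => n.
suff: forall m, (m <= n)%N -> coeff E m = 0 by apply.
elim: n => [|n IHn] m; first by rewrite leqn0 => /eqP->.
rewrite leq_eqVlt => /orP[/eqP->|]; last exact: IHn.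
(* As [E] vanishes up to order [n] in [u], the right side has no [u^n] term. On the left only the
   product of [coeff D 0] with [n + 1] times the next coefficient of [E] survives, since the [v]
   derivative does not lower the order in [u]. *)
have := congr1 (fun H => coeff H n) DE; rewrite !coeffM.
rewrite [RHS]big1 => [|i _]; last by rewrite IHn ?mul0r // -ltnS.
rewrite big_ord_recl big1 => [|i _]; last first.
  rewrite /fps_derivUV coeffB /= /bump add1n -subSn // subSS.
  by rewrite !IHn ?leq_subr ?leq_subLR ?leq_addl // mul0rn fps_deriv0 subrr mulr0.
rewrite addr0 subn0 /fps_derivUV coeffB /= (IHn n) // fps_deriv0 subr0 => /eqP.
by rewrite mulf_eq0 (negbTE D0) => /eqP; apply: (pchar0_mulrn_eq0 fps_pchar0).
Qed.

End Uniqueness.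

(* The identity D dN = N dD after division by a power of f'(u) f'(v), where g, s, t
   stand for g, g', g'' and, to avoid fractions, p1 = 4 q, p2 = 4 r, and the cubic
   coefficient is 2 c. *)
Lemma addition_wronskian_identity (R : comNzRingType) (q r c p gu gv su sv tu tv : R) :
  let k g s := 1 + s + 2 * q * g - 2 * (q ^+ 2 - r) * g ^+ 2 in
  let dk g s t := t + 2 * q * s - 4 * (q ^+ 2 - r) * g * s in
  let M := gu ^+ 2 * k gv sv - gv ^+ 2 * k gu su in
  let dM := 2 * gu * su * k gv sv - gu ^+ 2 * dk gv sv tv
     + 2 * gv * sv * k gu su - gv ^+ 2 * dk gu su tu in
  su ^+ 2 = 1 + 4 * q * gu + 4 * r * gu ^+ 2 + 2 * c * gu ^+ 3 + p * gu ^+ 4 ->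
  sv ^+ 2 = 1 + 4 * q * gv + 4 * r * gv ^+ 2 + 2 * c * gv ^+ 3 + p * gv ^+ 4 ->
  tu = 2 * q + 4 * r * gu + 3 * c * gu ^+ 2 + 2 * p * gu ^+ 3 ->
  tv = 2 * q + 4 * r * gv + 3 * c * gv ^+ 2 + 2 * p * gv ^+ 3 ->
  ((gu - gv) * M * (gv * (1 - su) - gu * (1 - sv))
    + gu * gv * ((gu - gv) * dM - M * (su + sv))) = 0.
Proof.
move=> k dk M dM hu hv tuE tvE; rewrite /dM /M /k /dk tuE tvE.
ring: hu hv.
Qed.

(** * The addition formula in terms of [g] with [g f' = f] *)

Section Addition.
Variable R : idomainType.
Hypothesis charR : [pchar R] =i pred0.
Variables (q r c p : R) (f g : {fps R}).
Let z := f^`S.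
Let s := g^`S.
(** Eliminating [f] and [f''] from twice [xi_1] by [f = g z] and [z' g = z (1 - s)] leaves
    [z ^+ 2 * k]. *)
Let k := 1 + s + fpsC (2 * q) * g - fpsC (2 * (q ^+ 2 - r)) * g ^+ 2.
Hypothesis f0 : coeff f 0 = 0.
Hypothesis z0 : coeff z 0 = 1.
Hypothesis gz : g * z = f.
Hypothesis s2 : s ^+ 2 = 1 + fpsC (4 * q) * g + fpsC (4 * r) * g ^+ 2
  + fpsC (2 * c) * g ^+ 3 + fpsC p * g ^+ 4.

Let g0 : coeff g 0 = 0.
Proof. by have := congr1 (fun F => coeff F 0%N) gz; rewrite coeff0M z0 mulr1 f0. Qed.

(** This is the derivative of [g z = f]; it serves to eliminate [f'']. *)
Lemma fps_deriv2_mul : z^`S * g = z * (1 - s).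
Proof.
have := congr1 (@fps_deriv _) gz; rewrite fps_derivM -/s -/z => zE.
by apply/eqP; rewrite mulrBr mulr1 -{2}zE; apply/eqP; ring.
Qed.
Let zg := fps_deriv2_mul.

(** The equation [s2] fixes this constant only up to sign; the constant term of [fps_deriv2_mul]
    decides it. *)
Let s0 : coeff s 0 = 1.
Proof.
have := congr1 (fun F => coeff F 0%N) zg.
rewrite !coeff0M g0 mulr0 z0 mul1r coeffB coeff1 => /esym/eqP.
by rewrite subr_eq0 => /eqP.
Qed.

(** Differentiate [s2] and cancel [2 s], which is nonzero because [s ^+ 2] has constant term 1. *)
Let s_deriv : s^`S = fpsC (2 * q) + fpsC (4 * r) * g + fpsC (3 * c) * g ^+ 2
  + fpsC (2 * p) * g ^+ 3.
Proof.
have s_neq0 : s != 0.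
  apply/eqP => s_0; have /eqP := congr1 (fun F => coeff F 0%N) s2.
  rewrite s_0 !coeffD !coeff_CM !exprS !coeff0M g0 !mul0r !mulr0 !addr0 coeff1.
  by rewrite eq_sym oner_eq0.
apply: (mulfI s_neq0); apply/eqP; rewrite -subr_eq0; apply/eqP.
apply: (@pchar0_mulrn_eq0 _ 1) (fps_pchar0 charR) _.
have := congr1 (@fps_deriv _) s2.
rewrite !fps_derivD fps_deriv1 !(fps_derivM (fpsC _)) !fps_derivXn !fps_derivC.
rewrite -/s => E; rewrite mulrnBl.
apply/eqP; rewrite subr_eq0; apply/eqP; transitivity (s ^+ 1 * s^`S *+ 2).
  by ring.
by rewrite E; ring.
Qed.

(** The values [f''(0)] and [f'''(0)] are read off at 0 from the first and second derivatives of
    [fps_deriv2_mul]. *)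
Lemma coeff_deriv23_0 :
  coeff z^`S 0 = - (2 * q) /\ coeff z^`S^`S 0 = 6 * q ^+ 2 - 2 * r.
Proof.
have zg1 : z^`S^`S * g + z^`S * s = z^`S * (1 - s) - z * s^`S.
  have := congr1 (@fps_deriv _) zg; rewrite !fps_derivM -/s => ->.
  by rewrite fps_derivB fps_deriv1; ring.
have zg2 : z^`S^`S^`S * g + z^`S^`S * s *+ 2 + z^`S * s^`S *+ 3
    = z^`S^`S * (1 - s) - z * s^`S^`S.
  have := congr1 (@fps_deriv _) zg1.
  rewrite [LHS]fps_derivD fps_derivB !fps_derivM fps_derivB fps_deriv1.
  rewrite -/s => /eqP; rewrite -subr_eq0 => /eqP E.
  by apply/eqP; rewrite -subr_eq0 -E -/z; apply/eqP; ring.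
have t0 : coeff s^`S 0 = 2 * q.
  by rewrite s_deriv !coeffD !(coeff0M (fpsC _)) !coeff0X g0 /=; ring.
have t'0 : coeff s^`S^`S 0 = 4 * r.
  rewrite s_deriv !fps_derivD !(fps_derivM (fpsC _)) !fps_derivXn !fps_derivC -/s.
  rewrite !mul0r !add0r !coeffD !(coeff0M (fpsC _)) !coeffMn !coeff0M !coeff0X.
  rewrite g0 -/s s0 /=; ring.
have z1 : coeff z^`S 0 = - (2 * q).
  have := congr1 (fun F => coeff F 0%N) zg1.
  rewrite coeffD coeffB !coeff0M coeffB coeff1 g0 s0 z0 t0 subrr mulr1 !mulr0 mul1r.
  by rewrite add0r sub0r.
split=> //.
have := congr1 (fun F => coeff F 0%N) zg2.
rewrite !(coeffD, coeffN, coeffMn, coeff0M) coeff1 g0 s0 z0 z1 t0 t'0.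
rewrite eqxx subrr => /eqP; rewrite -subr_eq0 => /eqP E.
apply/eqP; rewrite -subr_eq0; apply/eqP; apply: (@pchar0_mulrn_eq0 _ 1) charR _.
by rewrite -E; ring.
Qed.

Let k_deriv : k^`S = s^`S + fpsC (2 * q) * s - fpsC (4 * (q ^+ 2 - r)) * g * s.
Proof.
rewrite /k -mulNr -rmorphN !fps_derivD fps_deriv1 !(fps_derivM (fpsC _)) !fps_derivXn.
by rewrite !fps_derivC -/s; ring.
Qed.

(** Prescribing [xi *+ 2] instead of [xi] avoids the fraction 1/2, so that any domain of
    characteristic zero is allowed. *)
Lemma fps_addition_formula (xi : {fps R}) : xi *+ 2 = z ^+ 2 * k ->
  let N := fps_inU f ^+ 2 * fpsC xi - fpsC f ^+ 2 * fps_inU xi in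
  let D := fps_inU f * fpsC z - fpsC f * fps_inU z in
  D != 0 /\ (f \oS2 (fpsU + fpsV)) * D = N.
Proof.
move=> xi2 N D; set F := f \oS2 _.
have coeff0U G : coeff (fps_inU G) 0 = fpsC (coeff G 0) by [].
have coeff0V (G : {fps R}) : coeff (fpsC G) 0 = G by [].
have D0 : coeff D 0 = - f.
  by rewrite /D coeffB !coeff0M !coeff0U !coeff0V f0 z0 rmorph0 mul0r rmorph1 mulr1 sub0r.
have f_neq0 : f != 0.
  apply/eqP => f_0; have /eqP := z0.
  by rewrite /z f_0 fps_deriv0 coeff0 eq_sym oner_eq0.
have D_neq0 : D != 0 by apply: contraNneq f_neq0 => D_0; rewrite -oppr_eq0 -D0 D_0.
split=> //.
pose gu := fps_inU g; pose gv : {fps {fps R}} := fpsC g.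
pose zu := fps_inU z; pose zv : {fps {fps R}} := fpsC z.
pose su := fps_inU s; pose sv : {fps {fps R}} := fpsC s.
pose ku := fps_inU k; pose kv : {fps {fps R}} := fpsC k.
pose cst (a : R) : {fps {fps R}} := fpsC (fpsC a).
have DE : D = zu * zv * (gu - gv).
  by rewrite /D -gz !rmorphM -/gu -/gv -/zu -/zv; ring.
have N2E : N *+ 2 = zu * zu * (zv * zv) * (gu * gu * kv - gv * gv * ku).
  rewrite mulrnBl -!mulrnAr -!raddfMn xi2 -gz !rmorphM.
  by rewrite -/gu -/gv -/zu -/zv -/ku -/kv; ring.
(* The doubled difference is used because only twice [xi] is expressed through [k]. *)
suff E0 : N *+ 2 - F * D *+ 2 = 0.
  apply/esym/eqP; rewrite -subr_eq0; apply/eqP.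
  by apply: (@pchar0_mulrn_eq0 _ 1) (fps_pchar0 (fps_pchar0 charR)) _; rewrite mulrnBl.
pose wu := fps_inU z^`S; pose wv : {fps {fps R}} := fpsC z^`S.
pose tu := fps_inU s^`S; pose tv : {fps {fps R}} := fpsC s^`S.
have wuE : wu * gu = zu * (1 - su) by rewrite -rmorphM zg rmorphM rmorphB rmorph1.
have wvE : wv * gv = zv * (1 - sv) by rewrite -rmorphM zg rmorphM rmorphB rmorph1.
have dD : fps_derivUV D = (wu * zv - zu * wv) * (gu - gv) + zu * zv * (su + sv).
  rewrite DE !(fps_derivUVM, fps_derivUVB) !(fps_derivUV_inU, fps_derivUV_C).
  by rewrite -/z -/s -/gu -/gv -/zu -/zv -/su -/sv -/wu -/wv; ring.
have dN : fps_derivUV (N *+ 2) =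
    2 * (zu * zv) * (wu * zv - zu * wv) * (gu ^+ 2 * kv - gv ^+ 2 * ku)
    + (zu * zv) ^+ 2 * (2 * gu * su * kv - gu ^+ 2 * fpsC k^`S
      + 2 * gv * sv * ku - gv ^+ 2 * fps_inU k^`S).
  rewrite N2E !(fps_derivUVM, fps_derivUVB) !(fps_derivUV_inU, fps_derivUV_C).
  by rewrite -/z -/s -/gu -/gv -/zu -/zv -/su -/sv -/wu -/wv -/ku -/kv; ring.
(* After multiplication by [gu * gv], which is nonzero, [wuE] and [wvE] remove the second
   derivatives of [f]. What remains is [(zu * zv) ^+ 3] times the polynomial identity [id0]. *)
have wronskian : D * fps_derivUV (N *+ 2) = N *+ 2 * fps_derivUV D.
  have cstE (a : R) : fps_inU (fpsC a) = cst a by apply: fps_inU_C.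
  have kuE : ku = 1 + su + 2 * cst q * gu - 2 * (cst q ^+ 2 - cst r) * gu ^+ 2.
    by rewrite -!cstE /ku /k /su /gu; ring.
  have kvE : kv = 1 + sv + 2 * cst q * gv - 2 * (cst q ^+ 2 - cst r) * gv ^+ 2.
    by rewrite /cst /kv /k /sv /gv; ring.
  have dkuE : fps_inU k^`S = tu + 2 * cst q * su - 4 * (cst q ^+ 2 - cst r) * gu * su.
    by rewrite -!cstE k_deriv /su /gu /tu; ring.
  have dkvE : fpsC k^`S = tv + 2 * cst q * sv - 4 * (cst q ^+ 2 - cst r) * gv * sv.
    by rewrite /cst k_deriv /sv /gv /tv; ring.
  have id0 : (gu - gv) * (gu ^+ 2 * kv - gv ^+ 2 * ku) * (gv * (1 - su) - gu * (1 - sv))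
      + gu * gv * ((gu - gv) * (2 * gu * su * kv - gu ^+ 2 * fpsC k^`S
          + 2 * gv * sv * ku - gv ^+ 2 * fps_inU k^`S)
        - (gu ^+ 2 * kv - gv ^+ 2 * ku) * (su + sv)) = 0.
    rewrite kuE kvE dkuE dkvE; apply: (@addition_wronskian_identity _ _ _ (cst c) (cst p)).
    - by rewrite -!cstE -rmorphXn s2 /gu; ring.
    - by rewrite /cst -rmorphXn s2 /gv; ring.
    - by rewrite -!cstE /tu s_deriv /gu; ring.
    - by rewrite /cst /tv s_deriv /gv; ring.
  have guv_neq0 : gu * gv != 0.
    have g_neq0 : g != 0 by apply: contraNneq f_neq0; rewrite -gz => ->; rewrite mul0r.
    by rewrite mulf_neq0 // raddf_eq0 //; [exact: fps_inU_inj | exact: fpsC_inj].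
  apply: (mulfI guv_neq0); apply/eqP; rewrite -subr_eq0; apply/eqP.
  rewrite dN dD DE N2E; transitivity ((zu * zv) ^+ 3 * 0); last by rewrite mulr0.
  by rewrite -id0; ring: wuE wvE.
apply: (fps_derivUV_uniq charR (D := D)).
(* The derivation kills [F], so [F] behaves as a constant and [wronskian] passes to the
   difference. *)
- have -> : fps_derivUV (N *+ 2 - F * D *+ 2)
      = fps_derivUV (N *+ 2) - F * fps_derivUV D *+ 2.
    rewrite fps_derivUVB; congr (_ - _).
    have -> : F * D *+ 2 = F * (D *+ 2) by rewrite mulrnAr.
    rewrite fps_derivUVM fps_derivUV_comp2 mul0r add0r -mulrnAr.
    by congr (_ * _); apply: raddfMn.
  by move: wronskian; move: (fps_derivUV (N *+ 2)) => dN2 wronskian; ring: wronskian.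
- by rewrite D0 oppr_eq0.
(* At [u = 0] the term [N] is [- f(v)^2 xi(0)] and [F * D] is [- f(v)^2], so the difference vanishes
   there exactly because [xi(0) = 1]. *)
have xi0 : coeff xi 0 = 1.
  have := congr1 (fun F => coeff F 0%N) xi2.
  rewrite coeffMn exprS expr1 !coeff0M z0 !mul1r /k !coeffB !coeffD !coeff0M s0.
  rewrite g0 !mul0r !mulr0 subr0 addr0 coeff1 => /eqP.
  rewrite -subr_eq0 -[1 + 1]/(1 *+ 2) -mulrnBl => /eqP.
  by move/(pchar0_mulrn_eq0 charR)/eqP; rewrite subr_eq0 => /eqP.
have F0 : coeff F 0 = f.
  by apply: fpsP => j; rewrite coeff_comp2UV add0n bin0.
rewrite coeffB !coeffMn coeff0M D0 F0 /N coeffB !coeff0M !coeff0U !coeff0V f0 xi0.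
by rewrite rmorph0 rmorph1; ring.
Qed.

End Addition.

(** * From the defining equation of [B] to the equation for [g] *)

Lemma fps_deriv_inverse (R : comNzRingType) (B G f : {fps R}) :
  coeff f 0 = 0 -> B * G^`S = 1 -> G \oS f = fpsX -> B \oS f = f^`S.
Proof.
(* Differentiating [G(f(x)) = x] gives [G'(f) f' = 1], while [B(f) G'(f) = 1]. *)
move=> f0 BG /(congr1 (@fps_deriv _)); rewrite (fps_deriv_comp f0) fps_derivX => Gf'.
by rewrite -[LHS]mulr1 -Gf' mulrA -(fps_compM f0) BG fps_comp1 mul1r.
Qed.

Section Parametrization.
Variable R : idomainType.
Hypothesis charR : [pchar R] =i pred0.
Variables (h q r c p : R) (B S m f : {fps R}).
Hypothesis h2 : h * 2 = 1.
Hypothesis B0 : coeff B 0 = 1.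
Hypothesis mB : m * B = fpsX.
Hypothesis mS : B * m^`S = S \oS m.
Hypothesis S2 : S ^+ 2 = 1 + fpsC (4 * q) * fpsX + fpsC (4 * r) * fpsX ^+ 2
  + fpsC (2 * c) * fpsX ^+ 3 + fpsC p * fpsX ^+ 4.
Hypothesis f0 : coeff f 0 = 0.
Hypothesis Bf : B \oS f = f^`S.
Let A := B ^+ 2 - fpsC h * (fpsX * B * B^`S) + fpsC q * (fpsX * B)
  - fpsC (q ^+ 2 - r) * fpsX ^+ 2.
Let g := m \oS f.
Let z := f^`S.

Let m0 : coeff m 0 = 0.
Proof. by have := congr1 (fun F => coeff F 0%N) mB; rewrite coeff0M B0 mulr1. Qed.

Let gz : g * z = f.
Proof. by rewrite /z -Bf -(fps_compM f0) mB (fps_compX f0). Qed.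

Let z0 : coeff z 0 = 1.
Proof. by rewrite /z -Bf coeff0_comp. Qed.

(** By the chain rule [g' = m'(f) f' = (B m')(f) = S(m(f)) = S(g)], and [S ^+ 2] is the quartic. *)
Let s2 : g^`S ^+ 2 = 1 + fpsC (4 * q) * g + fpsC (4 * r) * g ^+ 2
  + fpsC (2 * c) * g ^+ 3 + fpsC p * g ^+ 4.
Proof.
have -> : g^`S = (S \oS m) \oS f.
  by rewrite (fps_deriv_comp f0) -mS (fps_compM f0) mulrC Bf.
rewrite -!fps_compXn // S2.
rewrite !fps_compD !(fps_compM m0 (fpsC _)) !fps_compXn // !fps_compC (fps_compX m0).
rewrite !(fps_compM f0 (fpsC _)) !fps_compXn // !fps_compC -/g.
by [].
Qed.

(** Here [B'(f)] is absorbed by [B'(f) B(f) = B'(f) f' = f'']. *)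
Let xiE : A \oS f
  = z ^+ 2 - fpsC h * (f * z^`S) + fpsC q * (f * z) - fpsC (q ^+ 2 - r) * f ^+ 2.
Proof.
rewrite /A !(fps_compD, fps_compN) !(fps_compM f0 (fpsC _)) !fps_compXn // !fps_compC.
rewrite !(fps_compM f0) (fps_compX f0) Bf -/z.
have -> : z^`S = (B^`S \oS f) * z by rewrite {1}/z -Bf (fps_deriv_comp f0).
by ring.
Qed.

Lemma fps_addition_formula_calA :
  let xi := A \oS f in
  let N := fps_inU f ^+ 2 * fpsC xi - fpsC f ^+ 2 * fps_inU xi in
  let D := fps_inU f * fpsC z - fpsC f * fps_inU z in
  D != 0 /\ (f \oS2 (fpsU + fpsV)) * D = N.
Proof.
apply: (fps_addition_formula charR f0 z0 gz s2).
have H2 : fpsC h *+ 2 = 1 by rewrite -[RHS](rmorph1 (@fpsC R)) -h2; ring.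
have zg := fps_deriv2_mul gz.
rewrite xiE -/z; transitivity (z ^+ 2 *+ 2 - (fpsC h *+ 2) * (f * z^`S)
  + fpsC q * (f * z) *+ 2 - fpsC (q ^+ 2 - r) * f ^+ 2 *+ 2); first by ring.
by rewrite H2 -gz; ring: zg.
Qed.

(** With [f''(0) = -2q] and [f'''(0) = 6q^2 - 2r], the coefficients [q] and [-(q^2 - r)] in [xiE]
    become [-f''(0)/2] and [(f''(0)^2 - f'''(0))/2]. *)
Lemma fps_calA_comp : A \oS f = z ^+ 2
  - fpsC h * ((z^`S + fpsC (coeff z^`S 0) * z) * f)
  + fpsC (h * (coeff z^`S 0 ^+ 2 - coeff z^`S^`S 0)) * f ^+ 2.
Proof.
have [-> ->] := coeff_deriv23_0 charR f0 z0 gz s2.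
have -> : h * ((- (2 * q)) ^+ 2 - (6 * q ^+ 2 - 2 * r)) = - (q ^+ 2 - r).
  transitivity (h * 2 * - (q ^+ 2 - r)); first by ring.
  by rewrite h2 mul1r.
have hq : fpsC h * fpsC (2 * q) = fpsC q by rewrite -rmorphM mulrA h2 mul1r.
rewrite xiE rmorphN; ring: hq.
Qed.

End Parametrization.

(** * Specialization to the rational polynomial ring in the four parameters *)

Lemma Qp_pchar0 : [pchar Qp] =i pred0.
Proof.
apply/pcharf0P => n; rewrite -(rmorph_nat (@mpoly.mpolyC 4 rat)).
by rewrite mpoly.mpolyC_eq0 (pcharf0P rat).1 //; apply: Num.Theory.pchar_num.
Qed.

(** Hence the divisions in [fps_int] and in the numerical constants are true quotients, not default
    values of the inverse. *)
Lemma Qp_natr_unit n : (n.+1%:R : Qp) \is a GRing.unit.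
Proof.
rewrite -(rmorph_nat (@mpoly.mpolyC 4 rat)) rmorph_unit // unitfE.
by rewrite (pcharf0P rat).1 //; apply: Num.Theory.pchar_num.
Qed.

Lemma fps_deriv_int (F : {fps Qp}) : (fps_int F)^`S = F.
Proof.
by apply: fpsP => n /=; rewrite -[LHS]mulr_natr divrK // Qp_natr_unit.
Qed.

Theorem corollary1p3 (S B f : {fps Qp})
    (hS : fps_sqrt S quartic)
    (hB0 : coeff B 0 = 1)
    (hB : B = (S \oS mu B) / (mu B)^`S)
    (hf : fps_comp_inverse f (fps_int B^-1)) :
  let xi1 := calA B \oS f in
  let xi2 := B \oS f in
  [/\ xi1 = f^`S ^+ 2
            - (1 / 2) *: ((f^`S^`S + coeff f^`S^`S 0 *: f^`S) * f)
            + (1 / 2 * (coeff f^`S^`S 0 ^+ 2 - coeff f^`S^`S^`S 0)) *: f ^+ 2,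
      xi2 = f^`S,
      (f \oS2 fpsU) * (xi2 \oS2 fpsV) - (f \oS2 fpsV) * (xi2 \oS2 fpsU) != 0 &
      tofrac (f \oS2 (fpsU + fpsV)) =
        tofrac ((f \oS2 fpsU) ^+ 2 * (xi1 \oS2 fpsV)
                - (f \oS2 fpsV) ^+ 2 * (xi1 \oS2 fpsU))
        / tofrac ((f \oS2 fpsU) * (xi2 \oS2 fpsV)
                - (f \oS2 fpsV) * (xi2 \oS2 fpsU))].
Proof.
move=> xi1 xi2; case: hf => f0 _ _ hf'; case: hS => _ S2.
(* Applied to [B] and to the derivative of [mu B], this makes the divisions in [mu] and [hB]
   genuine. *)
have unitE (F : {fps Qp}) : coeff F 0 = 1 -> F \is a GRing.unit.
  move=> F0; change (is_true (coeff F 0 \is a GRing.unit)).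
  by rewrite F0 unitr1.
have muB : mu B * B = fpsX by rewrite divrK // unitE.
have mu0 : coeff (mu B) 0 = 0.
  by have := congr1 (fun F => coeff F 0%N) muB; rewrite coeff0M hB0 mulr1.
have mu1 : coeff (mu B)^`S 0 = 1.
  have := congr1 (fun F => coeff F^`S 0%N) muB.
  by rewrite fps_derivM fps_derivX coeffD (coeff0M (mu B)^`S) (coeff0M (mu B))
    mu0 hB0 mulr1 mul0r addr0.
have muS : B * (mu B)^`S = S \oS mu B by rewrite {1}hB divrK // unitE.
have Bf : xi2 = f^`S.
  apply: (fps_deriv_inverse f0) hf'.
  by rewrite fps_deriv_int divrr ?unitE.
have inv2 : (1 / 2 * 2 = 1 :> Qp) by rewrite divrK // (Qp_natr_unit 1).
have inv4 : (4 * (1 / 4) = 1 :> Qp) by rewrite mul1r divrr // (Qp_natr_unit 3).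
(* These rescaled parameters are those in which the polynomial identity has integer coefficients. *)
pose q : Qp := 1 / 4 * p1; pose r : Qp := 1 / 4 * p2; pose c : Qp := 1 / 2 * p3.
have q4 : 4 * q = p1 by rewrite /q mulrA inv4 mul1r.
have r4 : 4 * r = p2 by rewrite /r mulrA inv4 mul1r.
have c2 : 2 * c = p3 by rewrite /c mulrA [2 * _]mulrC inv2 mul1r.
have q2 : 1 / 16 * p1 ^+ 2 = q ^+ 2.
  rewrite -q4; transitivity ((1 / 16 * 16) * q ^+ 2); first by ring.
  by rewrite divrK ?(Qp_natr_unit 15) // mul1r.
have S2' : S ^+ 2 = 1 + fpsC (4 * q) * fpsX + fpsC (4 * r) * fpsX ^+ 2
    + fpsC (2 * c) * fpsX ^+ 3 + fpsC p4 * fpsX ^+ 4.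
  by rewrite q4 r4 c2 -!fps_scaleC S2.
have AE : calA B = B ^+ 2 - fpsC (1 / 2) * (fpsX * B * B^`S) + fpsC q * (fpsX * B)
    - fpsC (q ^+ 2 - r) * fpsX ^+ 2.
  by rewrite -!fps_scaleC -q2.
have [D0 FD] := fps_addition_formula_calA Qp_pchar0 inv2 hB0 muB muS S2' f0 Bf.
rewrite /xi1 AE Bf !fps_comp2U !fps_comp2V; split.
- rewrite !fps_scaleC.
  exact: (fps_calA_comp Qp_pchar0 inv2 hB0 muB muS S2' f0 Bf).
- reflexivity.
- exact: D0.
(* The product form of the formula becomes a quotient in the fraction field since [D] is nonzero. *)
rewrite -FD rmorphM mulfK ?tofrac_eq0; [reflexivity | exact: D0].
Qed.
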